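(* Let $L$ be a Lawson compact algebraic $L$-domain, and let $CO(L)$ be the lattice of compact-open subsets of $L$ with the Scott topology, ordered by inclusion. Then $L$ is isomorphic (as a poset) to $pt(CO(L))$ under the isomorphism $\theta_L : L \to pt(CO(L))$ given by $$\theta_L(x) = \bigvee{}^{\uparrow}\{\gamma_{\uparrow k} : k \in {\downarrow}x \cap K(L)\}, \qquad x\in L,$$ where the directed supremum is taken in $pt(CO(L))$ and, for $k\in K(L)$, $\gamma_{\uparrow k}: CO(L)\to\{0,1\}$ is the map with $\gamma_{\uparrow k}(U)=1$ if ${\uparrow}k\subseteq U$ and $\gamma_{\uparrow k}(U)=0$ otherwise.
   Context: For a poset $P$ and $x\in P$: ${\uparrow}x=\{y\in P: y\ge x\}$, ${\downarrow}x=\{y\in P: y\le x\}$. A subset $D$ of $P$ is directed if every finite subset of $D$ (including the empty one) has an upper bound in $D$; $\bigvee^{\uparrow} D$ denotes the supremum of a directed set $D$. A dcpo is a poset in which every directed subset has a supremum. A subset $U\subseteq P$ is Scott open if it is an upper set and, for each directed $D$ whose supremum exists, $\bigvee^{\uparrow}D\in U$ implies $D\cap U\neq\emptyset$; the Scott open sets form the Scott topology $\sigma(P)$. An element $x\in P$ is compact if for every directed $D\subseteq P$ with existing supremum and $x\le\bigvee^{\uparrow}D$ there is $d\in D$ with $x\le d$; $K(P)$ is the set of compact elements. An algebraic domain is a dcpo $L$ such that for every $x\in L$ the set ${\downarrow}x\cap K(L)$ is directed and $x=\bigvee^{\uparrow}({\downarrow}x\cap K(L))$. An algebraic $L$-domain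 is an algebraic domain in which every principal ideal ${\downarrow}x$ is a complete lattice in its induced order. The lower topology $\omega(L)$ is generated by the sets $L\setminus{\uparrow}x$, $x\in L$, as subbasic open sets; the Lawson topology is the common refinement $\sigma(L)\vee\omega(L)$. $L$ is Lawson compact if it is compact in the Lawson topology. $CO(L)$ denotes the set of subsets of $L$ that are both compact and open in the Scott topology, ordered by inclusion. For a bounded distributive lattice $A$, a point of $A$ is a lattice homomorphism $A\to\{0,1\}$ (preserving $0$, $1$, binary meets and binary joins), and $pt(A)$ is the poset of all points of $A$ with the pointwise order ($0<1$). *)

(* Defs.v *)
From HB Require Import structures.
From mathcomp Require Import all_boot all_order.
From mathcomp Require Import finmap all_classical topology.

Set Implicit Arguments.
Unset Strict Implicit.
Unset Printing Implicit Defensive.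

Import Order.Theory.
Import SetOrder.Exports.
Local Open Scope order_scope.
Local Open Scope classical_set_scope.

Section Posets.
Context {d : Order.disp_t}.
Implicit Type P : porderType d.

Definition upset P (x : P) : set P := [set y | x <= y].
Definition downset P (x : P) : set P := [set y | y <= x].

(* The finite subset may be empty, so a directed set is nonempty. *)
Definition directed P (D : set P) : Prop :=
  forall F : set P, finite_set F -> F `<=` D -> exists2 z, D z & ubound F z.

Definition dcpo P : Prop :=
  forall D : set P, directed D -> exists s, isLub D s.

Definition complete_lattice P : Prop :=
  forall S : set P, (exists s, isLub S s) /\ (exists i, infimums S i).

Definition scott_open P (U : set P) : Prop :=
  (forall x y, x <= y -> U x -> U y) /\
  (forall (D : set P) s, directed D -> isLub D s -> U s -> D `&` U !=set0).

Definition compact_elements P : set P :=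
  [set x | forall (D : set P) s, directed D -> isLub D s -> x <= s ->
     exists2 y, D y & x <= y].

Definition algebraic_domain P : Prop :=
  dcpo P /\
  forall x : P, directed (downset x `&` @compact_elements P) /\
                isLub (downset x `&` @compact_elements P) x.

Record principal_ideal P (x : P) :=
  PrincipalIdeal { ideal_val : P; _ : ideal_val <= x }.
HB.instance Definition _ P (x : P) :=
  [isSub of principal_ideal x for @ideal_val P x].
HB.instance Definition _ P (x : P) := [Choice of principal_ideal x by <:].
HB.instance Definition _ P (x : P) :=
  [SubChoice_isSubPOrder of principal_ideal x by <: with d].

Definition algebraic_Ldomain P : Prop :=
  algebraic_domain P /\ forall x : P, complete_lattice (principal_ideal x).

Lemma directed2 P (D : set P) x y : directed D -> D x -> D y ->
  exists z, [/\ D z, x <= z & y <= z].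
Proof.
move=> dD Dx Dy; have [||z Dz zub] := dD [set x; y].
- exact: finite_set2.
- by move=> _ [->|->].
- by exists z; split => //; apply: zub; [left|right].
Qed.

Lemma scott_openT P : scott_open [set: P].
Proof.
split=> // D s dD _ _; have [//|z Dz _] := dD set0 (finite_set0 _).
by exists z.
Qed.

Lemma scott_openI P : setI_closed (@scott_open P).
Proof.
move=> U V [Uup Us] [Vup Vs]; split.
  by move=> x y xy [Ux Vx]; split; [exact: Uup xy Ux|exact: Vup xy Vx].
move=> D s dD Ds [/(Us _ _ dD Ds)[x [Dx Ux]] /(Vs _ _ dD Ds)[y [Dy Vy]]].
have [z [Dz xz yz]] := directed2 dD Dx Dy.
by exists z; split => //; split; [exact: Uup xz Ux|exact: Vup yz Vy].
Qed.

Lemma scott_open_bigU P (I : Type) (f : I -> set P) :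
  (forall i, scott_open (f i)) -> scott_open (\bigcup_i f i).
Proof.
move=> fo; split.
  by move=> x y xy [i _ fx]; exists i => //; exact: (fo i).1 xy fx.
move=> D s dD Ds [i _ /((fo i).2 _ _ dD Ds)[x [Dx fx]]].
by exists x; split => //; exists i.
Qed.

End Posets.
Arguments compact_elements {d} P.

Definition scott {d} (P : porderType d) : Type := P.
HB.instance Definition _ d (P : porderType d) := Choice.on (scott P).
HB.instance Definition _ d (P : porderType d) :=
  isOpenTopological.Build (scott P)
    (@scott_openT d P) (@scott_openI d P) (@scott_open_bigU d P).

Definition lower {d} (P : porderType d) : Type := P.
HB.instance Definition _ d (P : porderType d) := Choice.on (lower P).
HB.instance Definition _ d (P : porderType d) :=
  isSubBaseTopological.Build (lower P) (range (fun x : P => ~` upset x)) id.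

Definition lawson {d} (P : porderType d) : Type :=
  @sup_topology P bool (fun b =>
    if b then Topological.on (scott P) else Topological.on (lower P)).
HB.instance Definition _ d (P : porderType d) := Topological.on (lawson P).

Record lawson_compact_algebraic_Ldomain {d} (L : porderType d) : Prop := {
  lcaL_algebraic : algebraic_Ldomain L;
  lcaL_compact : compact [set: lawson L]
}.

Lemma scott_nbhs_lawson d (P : porderType d) (x : P) (A : set P) :
  nbhs (x : scott P) A -> nbhs (x : lawson P) A.
Proof.
move: A; exact: (iffLR
  (@cvg_sup P bool _ (nbhs (x : lawson P)) x _) (@cvg_id _ _) true).
Qed.

Lemma lower_nbhs_lawson d (P : porderType d) (x : P) (A : set P) :
  nbhs (x : lower P) A -> nbhs (x : lawson P) A.
Proof.
move: A; exact: (iffLR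
  (@cvg_sup P bool _ (nbhs (x : lawson P)) x _) (@cvg_id _ _) false).
Qed.

Lemma lower_open_upsetC d (P : porderType d) (x : P) :
  open (~` upset x : set (lower P)).
Proof.
exists [set ~` upset x]; last by rewrite bigcup_set1.
move=> _ ->; exists [fset ~` upset x]%fset; last by rewrite set_fset1 bigcap_set1.
by move=> A; rewrite in_fset1 => /eqP ->; rewrite inE; exists x.
Qed.

Lemma scott_open_upset d (P : porderType d) (k : P) :
  compact_elements P k -> open (upset k : set (scott P)).
Proof.
move=> kK; split=> [x y xy kx|D s dD Ds ks]; first exact: le_trans kx xy.
by have [y Dy ky] := kK D s dD Ds ks; exists y.
Qed.

Lemma lawson_compact_scott d (P : porderType d) (A : set P) :
  compact (A : set (lawson P)) -> compact (A : set (scott P)).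
Proof.
move=> cA F FF FA; have [x [Ax Fx]] := cA F FF FA.
by exists x; split=> // B C FB xC; apply: Fx => //; exact: scott_nbhs_lawson.
Qed.

Lemma scott_compact_open_lawson_closed d (P : porderType d) (U : set P) :
  algebraic_domain P -> open (U : set (scott P)) ->
  compact (U : set (scott P)) -> closed (U : set (lawson P)).
Proof.
move=> [_ algP] [Uup Us] /compact_near_coveringP cU.
rewrite -openC openE => x nUx.
have : \forall y \near (x : lawson P), U `<=` [set z | ~~ (z <= y)].
  apply: (cU (lawson P) (nbhs (x : lawson P)) (fun y z => ~~ (z <= y))) => u Uu.
  have [dD Du] := algP u.
  have [k [[ku kK] Uk]] := Us _ _ dD Du Uu.
  exists (upset k, ~` upset k) => /=; last first.
    move=> [z y] /= [kz nky]; apply: contra_notN nky; exact: le_trans.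
  split; first by apply: open_nbhs_nbhs; split => //; exact: scott_open_upset.
  apply: lower_nbhs_lawson; apply: open_nbhs_nbhs; split.
    exact: lower_open_upsetC.
  by move=> kx; apply: nUx; exact: Uup kx Uk.
rewrite /interior /=; apply: filterS => y Uy Uyy.
by have := Uy _ Uyy; rewrite /= lexx.
Qed.

Section CompactOpen.
Context {d : Order.disp_t} {L : porderType d}.
Implicit Type hL : lawson_compact_algebraic_Ldomain L.

Definition compact_open : {pred set L} :=
  fun U => `[< compact (U : set (scott L)) /\ open (U : set (scott L)) >].

Lemma compact_openP (U : set L) :
  reflect (compact (U : set (scott L)) /\ open (U : set (scott L)))
          (U \in compact_open).
Proof. exact: asboolP. Qed.

Lemma compact_open0 : (\bot : set L) \in compact_open.
Proof. by apply/compact_openP; split; [exact: compact0|exact: open0]. Qed.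

Lemma compact_openT hL : (\top : set L) \in compact_open.
Proof.
apply/compact_openP; split; last exact: openT.
exact: lawson_compact_scott (lcaL_compact hL).
Qed.

Lemma compact_openU :
  {in compact_open &, forall U V, (U `|` V)%O \in compact_open}.
Proof.
move=> U V /compact_openP[cU oU] /compact_openP[cV oV].
by apply/compact_openP; split; [exact: compactU|exact: openU].
Qed.

Lemma compact_openI hL :
  {in compact_open &, forall U V, (U `&` V)%O \in compact_open}.
Proof.
move=> U V /compact_openP[cU oU] /compact_openP[cV oV].
apply/compact_openP; split; last exact: openI.
have alg := (lcaL_algebraic hL).1.
apply: lawson_compact_scott.
apply: (subclosed_compact _ (lcaL_compact hL)) => //.
by apply: closedI; exact: scott_compact_open_lawson_closed.
Qed.

(* The carrier does not depend on hL; it is a parameter so that the bounded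
   lattice structure (meets and top need hL) can be inferred from the type. *)
Record CO hL := CompactOpen { CO_set :> set L; _ : CO_set \in compact_open }.

HB.instance Definition _ hL := [isSub of CO hL for @CO_set hL].
HB.instance Definition _ hL := [Choice of CO hL by <:].
HB.instance Definition _ hL :=
  Order.SubChoice_isTBSubLattice.Build _ _ _ set_display (CO hL)
    (compact_openI hL) compact_openU compact_open0 (compact_openT hL).

Lemma CO_meetUl hL : @left_distributive (CO hL) (CO hL) Order.meet Order.join.
Proof. by move=> U V W; apply: val_inj; exact: setIUl. Qed.

HB.instance Definition _ hL :=
  Order.Lattice_Meet_isDistrLattice.Build set_display (CO hL) (@CO_meetUl hL).

Lemma le_CO hL (U V : CO hL) : (U <= V) = `[< CO_set U `<=` CO_set V >].
Proof. by []. Qed.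

Lemma CO_botE hL : CO_set (\bot : CO hL) = set0.
Proof. by []. Qed.

Lemma CO_topE hL : CO_set (\top : CO hL) = setT.
Proof. by []. Qed.

Lemma CO_meetE hL (U V : CO hL) : CO_set (U `&` V)%O = CO_set U `&` CO_set V.
Proof. by []. Qed.

Lemma CO_joinE hL (U V : CO hL) : CO_set (U `|` V)%O = CO_set U `|` CO_set V.
Proof. by []. Qed.

End CompactOpen.

Section Points.
Context {d : Order.disp_t} (A : tbDistrLatticeType d).

(* {tblmorphism A -> bool} would not do: it does not require the preservation
   of binary meets and joins. *)
Definition is_point (p : A -> bool) : Prop :=
  [/\ p \bot = false, p \top = true,
      {morph p : a b / (a `&` b)%O >-> a && b} &
      {morph p : a b / (a `|` b)%O >-> a || b}].

(* As a subtype of A -> bool, pt inherits the pointwise order. *)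
Record pt := Point { pt_fun :> A -> bool; _ : `[< is_point pt_fun >] }.

HB.instance Definition _ := [isSub of pt for pt_fun].
HB.instance Definition _ := [Choice of pt by <:].
HB.instance Definition _ := [SubChoice_isSubPOrder of pt by <: with d].

Lemma le_pt (p q : pt) : reflect (forall a, p a -> q a) (p <= q).
Proof.
by apply: (iffP (lefP _ _)) => pq a; move: (pq a); rewrite leEbool /=;
  case: (pt_fun p a); case: (pt_fun q a) => // /(_ isT).
Qed.

End Points.

Section Gamma.
Context {d : Order.disp_t} {L : porderType d}.
Variable hL : lawson_compact_algebraic_Ldomain L.

Definition gamma_upset_fun (k : L) (U : CO hL) : bool := `[< upset k `<=` U >].

Lemma gamma_upset_is_point (k : L) : is_point (gamma_upset_fun k).
Proof.
have gE (U : CO hL) : gamma_upset_fun k U = `[< CO_set U k >].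
  apply: asbool_equiv_eq; split=> [|Uk x kx]; first by apply; exact: lexx.
  by case: U Uk => U /= /compact_openP[_ [Uup _]]; exact: Uup kx.
split=> [| |U V|U V]; rewrite !gE /=.
- exact/asboolP.
- exact/asboolP.
- exact: asbool_and.
- exact: asbool_or.
Qed.

Definition gamma_upset (k : L) : pt (CO hL) :=
  Point (asboolT (gamma_upset_is_point k)).

End Gamma.

(* Main.v *)
Require Import Defs.
From mathcomp Require Import all_boot all_order.
From mathcomp Require Import all_classical topology.

(** In an algebraic domain a Scott open set is the union of the principal
    filters of its compact elements, and such a filter is itself compact-open.
    So a compact-open set is a finite join, in the lattice of compact-open sets,
    of filters of compact elements, and a point [p] (being prime) holds at [U]
    exactly when it holds at the filter of some compact [k] in [U]
    ([point_compact_element]).  A point is thus determined by the set [D] of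
    compact elements whose filter satisfies it.

    [D] is directed: the whole space is compact-open, which makes [D] nonempty,
    and the filters of [k1] and [k2] meet in a compact-open set where [p] holds,
    so some [k] in [D] lies above both; Lawson compactness enters through these
    two closure properties of the lattice.  If [x] is the supremum of [D], then
    [x] belongs to [U] iff some member of [D] does, i.e. iff [p] holds at [U].
    Hence every point is evaluation at an element of [L] ([point_spatial]).

    The isomorphism itself is [x |-> gamma_upset x]: the formula defining
    [gamma_upset] gives a point for every [x], namely evaluation at [x]
    ([gamma_upsetE]), and it is the directed supremum of the [gamma_upset k]
    for [k] compact below [x] because compact-open sets are Scott open. *)

Local Open Scope order_scope.
Local Open Scope classical_set_scope.

Section Directed.
Set Implicit Arguments.
Unset Strict Implicit.
Import Order.Theory.

Lemma directed_binary d (P : porderType d) (D : set P) : D !=set0 ->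
  (forall x y, D x -> D y -> exists z, [/\ D z, x <= z & y <= z]) -> directed D.
Proof.
move=> [x0 Dx0] D2 F /finite_seqP[s ->].
elim: s => [|a s IH] sD; first by exists x0.
have [|z Dz zub] := IH; first by move=> x xs; apply: sD; rewrite /= inE xs orbT.
have [|w [Dw aw zw]] := D2 a z _ Dz; first by apply: sD; rewrite /= inE eqxx.
exists w => // x; rewrite /= inE => /orP[/eqP ->//|xs].
exact: le_trans (zub x xs) zw.
Qed.

Lemma directed_nonempty d (P : porderType d) (D : set P) : directed D -> D !=set0.
Proof. by move=> /(_ set0 (finite_set0 _))[//|z Dz _]; exists z. Qed.

Lemma directed_image d d' (P : porderType d) (Q : porderType d') (f : P -> Q)
    (D : set P) :
  {homo f : x y / x <= y} -> directed D -> directed (f @` D).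
Proof.
move=> fmono dD; apply: directed_binary.
  by have [z Dz] := directed_nonempty dD; exists (f z); exists z.
move=> _ _ [x Dx <-] [y Dy <-]; have [z [Dz xz yz]] := directed2 dD Dx Dy.
by exists (f z); split; [exists z|exact: fmono|exact: fmono].
Qed.

End Directed.

Section CompactOpenFilters.
Set Implicit Arguments.
Unset Strict Implicit.
Import Order.Theory.
Context {d : Order.disp_t} {L : porderType d}.

(** Every Scott neighbourhood of [x] contains all of [upset x], so a cover of
    [upset x] is already a cover by the one member containing [x]. *)
Lemma scott_compact_upset (x : L) : compact (upset x : set (scott L)).
Proof.
apply/compact_near_coveringP => I F P FF /(_ x (lexx x))[[A B] /= [xA FB] AB].
apply: filterS FB => i Bi y xy; apply: (AB (y, i)); split=> //=.
have := xA; rewrite nbhsE => -[V [[Vup _] Vx] VA].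
exact/VA/(Vup x y).
Qed.

Lemma upset_CO (k : L) : compact_elements L k -> upset k \in Defs.compact_open.
Proof.
move=> kK; apply/compact_openP.
by split; [exact: scott_compact_upset|exact: scott_open_upset].
Qed.

Variable hL : lawson_compact_algebraic_Ldomain L.

Definition filter_CO (k : L) (kK : compact_elements L k) : CO hL :=
  CompactOpen hL (upset_CO kK).

Lemma scott_open_CO (U : CO hL) : scott_open (CO_set U).
Proof. by case: U => U /= /compact_openP[]. Qed.

Lemma filter_CO_le (k : L) (kK : compact_elements L k) (U : CO hL) :
  CO_set U k -> filter_CO kK <= U.
Proof.
by rewrite le_CO => Uk; apply/asboolP => x kx; exact: (scott_open_CO U).1 Uk.
Qed.

Lemma CO_compact_element (U : CO hL) (x : L) : CO_set U x ->
  exists k, [/\ compact_elements L k, k <= x & CO_set U k].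
Proof.
move=> Ux; have [dD Dx] := (lcaL_algebraic hL).1.2 x.
have [k [[kx kK] Uk]] := (scott_open_CO U).2 _ _ dD Dx Ux.
by exists k.
Qed.

Lemma point_bot (p : pt (CO hL)) : p \bot = false.
Proof. by case: p => p /= /asboolP[]. Qed.

Lemma point_top (p : pt (CO hL)) : p \top.
Proof. by case: p => p /= /asboolP[]. Qed.

Lemma point_meet (p : pt (CO hL)) U V : p (U `&` V)%O = p U && p V.
Proof. by case: p => p /= /asboolP[]. Qed.

Lemma point_join (p : pt (CO hL)) U V : p (U `|` V)%O = p U || p V.
Proof. by case: p => p /= /asboolP[]. Qed.

Lemma point_le (p : pt (CO hL)) U V : U <= V -> p U -> p V.
Proof. by move=> /join_idPr <- pU; rewrite point_join pU. Qed.

(** A prime filter meets every finite cover of its members.  Compactness of [U]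
    is used in its near-covering form, for the filter on the lattice generated
    by the principal filters of the [W] with [~~ p W]: primality says exactly
    that these [W] are closed under joins. *)
Lemma point_compact_element (p : pt (CO hL)) (U : CO hL) : p U ->
  exists k (kK : compact_elements L k), CO_set U k /\ p (filter_CO kK).
Proof.
move=> pU; apply: contrapT => nk.
pose F : set_system (CO hL) :=
  [set A | exists2 W, ~~ p W & forall V, W <= V -> A V].
have FF : Filter F.
  split=> [|A B [V nV VA] [W nW WB]|A B AB [W nW WA]].
  - by exists \bot => //; rewrite point_bot.
  - exists (V `|` W)%O; first by rewrite point_join negb_or nV.
    move=> X; rewrite leUx => /andP[VX WX].
    by split; [exact: VA|exact: WB].
  - by exists W => // V /WA/AB.
have cU : near_covering (CO_set U : set (scott L)).
  by apply/compact_near_coveringP; case: (U) => V /= /compact_openP[].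
have [x Ux|W nW UW] := cU _ F (fun V x => CO_set V x) FF.
  have [k [kK kx Uk]] := CO_compact_element Ux.
  exists (upset k, [set V | filter_CO kK <= V]) => /=.
    split; first by apply: open_nbhs_nbhs; split=> //; exact: scott_open_upset.
    by exists (filter_CO kK) => //; apply/negP => pk; apply: nk; exists k, kK.
  by move=> [y V] /= [ky]; rewrite le_CO => /asboolP; apply.
have UleW : U <= W by rewrite le_CO; apply/asboolP; exact: UW (lexx W).
by have := point_le UleW pU; apply/negP.
Qed.

Lemma gamma_upsetE (x : L) (U : CO hL) :
  gamma_upset hL x U = `[< CO_set U x >].
Proof.
apply: asbool_equiv_eq; split=> [|Ux y xy]; first by apply; exact: lexx.
exact: (scott_open_CO U).1 Ux.
Qed.

(** The order of [L] is recovered from its compact-open sets because each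
    element is the supremum of the compact elements below it. *)
Lemma gamma_upset_mono : {mono gamma_upset hL : x y / x <= y}.
Proof.
move=> x y; apply/idP/idP => [/le_pt xy|xy].
  have [_ [_ xlub]] := (lcaL_algebraic hL).1.2 x.
  apply: xlub => k [kx kK].
  have := xy (filter_CO kK); rewrite !gamma_upsetE => /(_ (asboolT kx)).
  by move=> /asboolP.
apply/le_pt => U; rewrite !gamma_upsetE => /asboolP Ux; apply/asboolP.
exact: (scott_open_CO U).1 Ux.
Qed.

Lemma gamma_upset_isLub (x : L) :
  isLub [set gamma_upset hL k | k in downset x `&` compact_elements L]
        (gamma_upset hL x).
Proof.
split=> [_ [k [kx _] <-]|p pub]; first by rewrite gamma_upset_mono.
apply/le_pt => U; rewrite gamma_upsetE => /asboolP/CO_compact_element.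
move=> [k [kK kx Uk]]; have /le_pt := pub _ (imageP _ (conj kx kK)).
by apply; rewrite gamma_upsetE; apply/asboolP.
Qed.

Lemma point_spatial (p : pt (CO hL)) : exists x, gamma_upset hL x = p.
Proof.
pose D := [set k | exists kK : compact_elements L k, p (filter_CO kK)].
have dD : directed D.
  apply: directed_binary.
    have [k [kK [_ pk]]] := point_compact_element (point_top p).
    by exists k; exists kK.
  move=> k1 k2 [k1K pk1] [k2K pk2].
  have : p (filter_CO k1K `&` filter_CO k2K)%O by rewrite point_meet pk1.
  move=> /point_compact_element[k [kK [[k1k k2k] pk]]].
  by exists k; split=> //; exists kK.
have [x Dx] := (lcaL_algebraic hL).1.1 D dD.
exists x; apply: val_inj; apply/funext => U.
apply: etrans (gamma_upsetE x U) _; apply/asboolP/idP => [Ux|].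
  have [k [[kK pk] Uk]] := (scott_open_CO U).2 _ _ dD Dx Ux.
  exact: point_le (filter_CO_le kK Uk) pk.
move=> /point_compact_element[k [kK [Uk pk]]].
by apply: (scott_open_CO U).1 Uk; apply: Dx.1; exists kK.
Qed.

End CompactOpenFilters.

Theorem corollary3p7 (d : Order.disp_t) (L : porderType d)
    (hL : lawson_compact_algebraic_Ldomain L) :
  exists theta : L -> pt (CO hL),
    [/\ (forall x : L,
           directed [set gamma_upset hL k |
                      k in downset x `&` compact_elements L] /\
           isLub [set gamma_upset hL k |
                   k in downset x `&` compact_elements L] (theta x)),
        bijective theta
      & {mono theta : x y / x <= y}].
Proof.
exists (gamma_upset hL); split; last exact: gamma_upset_mono.
  move=> x; split; last exact: gamma_upset_isLub.
  apply: directed_image ((lcaL_algebraic hL).1.2 x).1 => k l.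
  by rewrite gamma_upset_mono.
have [g gK] := choice (@point_spatial d L hL).
exists g => // x.
by apply: (Order.POrderTheory.inc_inj (@gamma_upset_mono d L hL)); rewrite gK.
Qed.
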